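(* Let $\mathbf{x}=(x_1,\dots,x_n)^\top$ be an i.i.d. sample from the skew-normal distribution with pdf $$s(x\mid\mu,\sigma,\alpha)=\frac{2}{\sigma}\phi\left(\frac{x-\mu}{\sigma}\right)\Phi\left(\alpha\,\frac{x-\mu}{\sigma}\right),\qquad x\in\mathbb{R},$$ where $\mu\in\mathbb{R}$, $\sigma\in(0,\infty)$, $\alpha\in\mathbb{R}$, and $\phi$, $\Phi$ are the standard normal pdf and cdf. Consider the improper product prior $$\pi(\mu,\sigma,\alpha)\propto\sqrt{\int_{-\infty}^{\infty}\frac{\sqrt{2}\,e^{-\frac12(2\alpha^2+1)x^2}}{\pi^{3/2}(\alpha^2+1)^2\left(\operatorname{erf}\left(\frac{\alpha x}{\sqrt2}\right)+1\right)}\,dx}.$$ Then, the posterior distribution of $(\mu,\sigma,\alpha)$ is proper if $n>2$.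
   Context: The prior is the product of the flat prior $\pi_W(\mu,\sigma)\propto 1$ (the Wasserstein prior of a location-scale family) and the Wasserstein prior $\pi_W(\alpha)$ of the skewness parameter of the skew-normal distribution with pdf $2\phi(x)\Phi(\alpha x)$, whose expression is the square root displayed in the claim. The Wasserstein prior of a model with cdf $F(x\mid\theta)$ and pdf $f(x\mid\theta)$ is, up to a positive proportionality constant, the square root of the determinant of the Wasserstein information matrix, whose entries are $W_{ij}(\theta)=\mathbb{E}\left[\frac{\partial_{\theta_i}F(X\mid\theta)\,\partial_{\theta_j}F(X\mid\theta)}{f(X\mid\theta)^2}\right]$ with $X\sim F(\cdot\mid\theta)$. In the formula for the prior, $x$ is a dummy integration variable and on the right-hand side $\pi$ denotes the number. Here $\operatorname{erf}(z)=\frac{2}{\sqrt\pi}\int_0^z e^{-t^2}dt$. The posterior distribution is called proper if the marginal likelihood (normalising constant) $$m(\mathbf{x})=\int_0^\infty\int_{-\infty}^\infty\int_{-\infty}^\infty\left[\prod_{i=1}^n s(x_i\mid\mu,\sigma,\alpha)\right]\pi(\mu,\sigma,\alpha)\,d\mu\,d\alpha\,d\sigma$$ is finite. *)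

(* Defs.v *)
From HB Require Import structures.
From mathcomp Require Import all_boot all_order all_algebra.
From mathcomp Require Import all_classical all_reals all_analysis.
Set Implicit Arguments.
Unset Strict Implicit.
Unset Printing Implicit Defensive.
Import Order.TTheory GRing.Theory Num.Theory.
Import numFieldNormedType.Exports.
Local Open Scope classical_set_scope.
Local Open Scope ring_scope.

Definition std_normal_pdf (R : realType) (x : R) : R := normal_pdf 0 1 x.

Definition std_normal_cdf (R : realType) (x : R) : R :=
  fine (normal_prob 0 1 `]-oo, x]).

(* The oriented integral from 0 to z is split according to the sign of z. *)
Definition erf (R : realType) (z : R) : R :=
  2 / Num.sqrt pi *
  (if 0 <= z
   then Rintegral lebesgue_measure `[0, z] (fun t => expR (- t ^+ 2))
   else - Rintegral lebesgue_measure `[z, 0] (fun t => expR (- t ^+ 2))).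

Definition skew_normal_pdf (R : realType) (mu sigma alpha x : R) : R :=
  2 / sigma * std_normal_pdf ((x - mu) / sigma)
            * std_normal_cdf (alpha * ((x - mu) / sigma)).

Definition mutually_independent (d : measure_display) (T : measurableType d)
    (R : realType) (P : probability T R) (n : nat)
    (X : 'I_n -> {RV P >-> R}) : Prop :=
  forall (J : {set 'I_n}) (A : 'I_n -> set R),
    (forall i, i \in J -> measurable (A i)) ->
    P (\bigcap_(i in [set` J]) (X i @^-1` A i))
      = (\prod_(i in J) P (X i @^-1` A i))%E.

Definition iid_skew_normal_sample (d : measure_display) (T : measurableType d)
    (R : realType) (P : probability T R) (n : nat)
    (X : 'I_n -> {RV P >-> R}) (mu sigma alpha : R) : Prop :=
  mutually_independent X /\
  forall (i : 'I_n) (A : set R), measurable A ->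
    distribution P (X i) A
      = (\int[lebesgue_measure]_(x in A)
           (skew_normal_pdf mu sigma alpha x)%:E)%E.

(* Extended-real valued, so that finiteness of the integral is not presupposed. *)
Definition skew_normal_wasserstein_kernel (R : realType) (alpha : R) : \bar R :=
  sqrte (\int[lebesgue_measure]_(x in [set: R])
    (Num.sqrt 2 * expR (- (1 / 2 * (2 * alpha ^+ 2 + 1) * x ^+ 2)) /
     (pi `^ (3 / 2) * (alpha ^+ 2 + 1) ^+ 2
        * (erf (alpha * x / Num.sqrt 2) + 1)))%:E)%E.

(* The prior is constant in (mu, sigma); it may be arbitrary outside the
   parameter space sigma > 0. *)
Definition is_skew_normal_wasserstein_prior (R : realType)
    (prior : R -> R -> R -> \bar R) : Prop :=
  exists c : R, 0 < c /\
    forall mu sigma alpha : R, 0 < sigma ->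
      prior mu sigma alpha = (c%:E * skew_normal_wasserstein_kernel alpha)%E.

Definition marginal_likelihood (R : realType) (prior : R -> R -> R -> \bar R)
    (n : nat) (x : 'I_n -> R) : \bar R :=
  (\int[lebesgue_measure]_(sigma in `]0%R, +oo[)
     \int[lebesgue_measure]_(alpha in [set: R])
       \int[lebesgue_measure]_(mu in [set: R])
         ((\prod_(i < n) skew_normal_pdf mu sigma alpha (x i))%:E
            * prior mu sigma alpha))%E.

Definition posterior_proper (R : realType) (prior : R -> R -> R -> \bar R)
    (n : nat) (x : 'I_n -> R) : Prop :=
  (marginal_likelihood prior x < +oo)%E.

(* Main.v *)
Require Import Defs.
From HB Require Import structures.
From mathcomp Require Import all_boot all_order all_algebra.
From mathcomp Require Import all_classical all_reals all_analysis.
From mathcomp Require Import measurable_realfun ring lra.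
Set Implicit Arguments.
Unset Strict Implicit.
Unset Printing Implicit Defensive.
Import Order.TTheory GRing.Theory Num.Theory.
Import numFieldNormedType.Exports.
Local Open Scope classical_set_scope.
Local Open Scope ring_scope.

(** Since Phi <= 1, the likelihood is at most that of a normal sample, so alpha
    enters only through the prior. Writing the left tail as a Gaussian integral
    gives 1 + erf z >= c exp (- 2 z^2) for some c > 0; with z = alpha x / sqrt 2
    the factor exp (- alpha^2 x^2) in the integrand absorbs 1 / (1 + erf z), so
    the prior is O (1 / (1 + alpha^2)), which is integrable. If two observations
    differ, with D a multiple of the square of their difference, integrating mu
    out leaves a multiple of sigma^(1-n) exp (- D / sigma^2), which is
    O (1 / (1 + sigma^2)) when n > 2. Finally, two independent observations with
    a bounded density almost surely differ. *)

(* Unlike [ge0_le_integral], no measurability is assumed: iterated integrals of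
   the prior can then be bounded without side conditions. *)
Lemma ge0_le_integral_majorant d (T : measurableType d) (R : realType)
    (mu : {measure set T -> \bar R}) (D : set T) (f g : T -> \bar R) :
  (forall x, D x -> (0 <= f x)%E) -> (forall x, D x -> (f x <= g x)%E) ->
  (\int[mu]_(x in D) f x <= \int[mu]_(x in D) g x)%E.
Proof.
move=> f0 fg; have g0 x : D x -> (0 <= g x)%E.
  by move=> Dx; exact: le_trans (f0 x Dx) (fg x Dx).
rewrite !ge0_integralE//; apply: le_ereal_sup => _ [h hf <-].
exists h => // x; exact: le_trans (hf x) (lee_restrict fg x).
Qed.

(** * Powers against exponentials, and the integral of [1 / (1 + x ^+ 2)] *)

(** For [x >= 0], [x ^+ k / k!] is a single term of the exponential series, whose terms are all
    nonnegative. *)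
Lemma exprn_expRN_le (R : realType) (k : nat) (x : R) :
  0 <= x -> x ^+ k * expR (- x) <= k`!%:R.
Proof.
move=> x0; rewrite expRN ler_pdivrMr ?expR_gt0// mulrC.
rewrite -ler_pdivrMr ?ltr0n ?fact_gt0//; case: k => [|k].
  by rewrite expr0 fact0 divr1 -expR0 ler_expR.
by apply: le_trans (expR_ge1Dxn k x0); rewrite lerDr.
Qed.

Lemma exprn_le1D (R : realDomainType) (j k : nat) (x : R) :
  0 <= x -> (j <= k)%N -> x ^+ j <= 1 + x ^+ k.
Proof.
move=> x0 jk; have [x1|/ltW x1] := leP x 1.
  by rewrite (le_trans (exprn_ile1 _ _ _))// lerDl exprn_ge0.
by rewrite (le_trans (ler_weXn2l x1 jk))// lerDr.
Qed.

(** With [u = 1 / s], multiplying by [1 + s ^+ 2] turns the left side into [(u ^+ k + u ^+ (k - 2))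
    * expR (- (D * u ^+ 2))]. Both powers are at most [1 + u ^+ (2 * k)], and [u ^+ (2 * k) = (D * u
    ^+ 2) ^+ k / D ^+ k] is absorbed by the exponential up to [k! / D ^+ k]. *)
Lemma expr_inv_expRN_decay (R : realType) (k : nat) (D : R) :
  (2 <= k)%N -> 0 < D -> exists2 M : R, 0 <= M &
    forall s : R, 0 < s -> s ^- k * expR (- (D / s ^+ 2)) <= M / (1 + s ^+ 2).
Proof.
move=> k2 D0; exists (2 * (1 + k`!%:R / D ^+ k)).
  by rewrite mulr_ge0// addr_ge0// divr_ge0 ?exprn_ge0 ?ltW.
move=> s s0; have s2 : 0 < 1 + s ^+ 2 by rewrite ltr_pwDl// sqr_ge0.
rewrite ler_pdivlMr// -exprVn; set u := s^-1.
have u0 : 0 <= u by rewrite invr_ge0 ltW.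
have us : u ^+ k * s ^+ 2 = u ^+ (k - 2).
  by rewrite -{1}(subnK k2) exprD -mulrA -exprMn mulVf ?gt_eqF// expr1n mulr1.
have yE : D / s ^+ 2 = D * (u ^+ 2) by rewrite exprVn.
have y0 : 0 <= D * u ^+ 2 by rewrite mulr_ge0 ?sqr_ge0// ltW.
rewrite yE mulrAC mulrDr mulr1 us.
have h : u ^+ k + u ^+ (k - 2) <= 2 * (1 + u ^+ (2 * k)).
  rewrite mulr_natl mulr2n lerD ?exprn_le1D//; first by rewrite leq_pmull.
  by rewrite (leq_trans (leq_subr _ _))// leq_pmull.
apply: (le_trans (ler_wpM2r (expR_ge0 _) h)).
rewrite -mulrA ler_pM2l// mulrDl mul1r lerD//.
  by rewrite expR_le1 oppr_le0.
rewrite ler_pdivlMr ?exprn_gt0// mulrC mulrA exprM -exprMn.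
exact: exprn_expRN_le.
Qed.

Lemma integral_oneDsqrV_fin (R : realType) :
  (\int[lebesgue_measure]_(x in [set: R]) ((1 + x ^+ 2)^-1)%:E < +oo)%E.
Proof.
rewrite (@ge0_symfun_integralT R (fun x => (oneDsqr x)^-1)).
- rewrite (_ : [set x | _] = `[0%R, +oo[%classic); last first.
    by apply/seteqP; split => x/=; rewrite in_itv/= andbT.
  by rewrite integral0y_oneDsqr -EFinM ltry.
- by move=> x; rewrite invr_ge0.
- exact: continuous_oneDsqrV.
- by move=> x /=; rewrite /oneDsqr sqrrN.
Qed.

Lemma measurable_oneDsqrV (R : realType) (A : set R) :
  measurable_fun A (fun x : R => (1 + x ^+ 2)^-1).
Proof.
apply: measurable_funTS.
apply: continuous_measurable_fun; exact: continuous_oneDsqrV.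
Qed.

(** * Gaussian tails and the lower bound on [1 + erf] *)

Lemma integral_gauss_ltNy0 (R : realType) :
  (\int[lebesgue_measure]_(x in `]-oo, 0%R[) (@gauss_fun R x)%:E
     = (Num.sqrt pi / 2)%:E)%E.
Proof.
have := @integralT_gauss R; rewrite -(setUv `]-oo, (0:R)[) setCitvl.
rewrite ge0_integral_setU//=; last 3 first.
- by apply/measurable_EFinP/measurable_funTS; exact: measurable_gauss_fun.
- by move=> x _; rewrite lee_fin gauss_fun_ge0.
- by rewrite -setCitvl; exact/disj_setPCl.
rewrite integral0y_gauss.
case: (integral _ _ _) => [r| |]//=; rewrite -EFinD => -[rE].
by congr EFin; lra.
Qed.

Lemma erf_lower_bound (R : realType) :
  exists2 c : R, 0 < c & forall z : R, c * expR (- (2 * z ^+ 2)) <= 1 + erf z.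
Proof.
have pi0 : 0 < Num.sqrt (pi : R) by rewrite sqrtr_gt0 pi_gt0.
have pi1 : 1 <= Num.sqrt (pi : R).
  by rewrite -sqrtr1 ler_sqrt ?(le_trans _ (pi_ge2 R))// ler1n.
exists (2 / Num.sqrt pi * expR (-2)).
  by rewrite mulr_gt0 ?divr_gt0 ?expR_gt0.
move=> z; rewrite /erf; case: ifPn => [z0|].
  (* For [z >= 0], [erf z >= 0], and the left side is at most 1 because [2 <= expR 2] and
     [1 <= Num.sqrt pi]. *)
  apply: (@le_trans _ _ 1); last first.
    rewrite lerDl mulr_ge0 ?divr_ge0 ?sqrtr_ge0// Rintegral_ge0//.
  rewrite -(mulrA (2 / _)) -expRD; apply: (@le_trans _ _ (2 * expR (-2))).
    apply: ler_pM; [by rewrite divr_ge0 ?sqrtr_ge0|exact: expR_ge0| |].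
      by rewrite ler_pdivrMr// ler_peMr.
    by rewrite ler_expR gerDl oppr_le0 mulr_ge0 ?sqr_ge0.
  by rewrite expRN ler_pdivrMr ?expR_gt0// mul1r; have := @expR_ge1Dx R 2; lra.
rewrite -ltNge => z0.
have mg A : measurable_fun A (EFin \o @gauss_fun R).
  by apply/measurable_EFinP/measurable_funTS; exact: measurable_gauss_fun.
have g0 (x : R) : (0 <= (gauss_fun x)%:E)%E by rewrite lee_fin gauss_fun_ge0.
pose I := Rintegral lebesgue_measure `[z, 0] (fun t : R => expR (- t ^+ 2)).
(* For [z < 0], the Gaussian mass of []-oo, 0[] is at least that of [[z, 0[] plus that of the unit
   interval [[z - 1, z[], which bounds the remaining tail from below. *)
have key : expR (-2) * expR (- (2 * z ^+ 2)) + I <= Num.sqrt pi / 2.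
  have : ((expR (-2) * expR (- (2 * z ^+ 2)))%:E +
      \int[lebesgue_measure]_(x in `[z, 0%R[) (gauss_fun x)%:E
      <= (Num.sqrt pi / 2)%:E)%E.
    rewrite -integral_gauss_ltNy0.
    apply: (@le_trans _ _ (\int[lebesgue_measure]_(x in
        `[(z - 1)%R, z[ `|` `[z, 0%R[) (gauss_fun x)%:E)%E); last first.
      apply: ge0_subset_integral => //; [exact: measurableU|exact: mg|].
      move=> x /= []; rewrite !in_itv/= => /andP[_ xz] //.
      exact: lt_trans xz z0.
    rewrite ge0_integral_setU//; last 2 first.
    - exact: mg.
    - apply/disj_setPS => x /= []; rewrite !in_itv/= => /andP[_ xz] /andP[zx _].
      by move: (lt_le_trans xz zx); rewrite ltxx.
    rewrite leeD2r//.
    apply: (@le_trans _ _ (\int[lebesgue_measure]_(x in `[(z - 1)%R, z[)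
        (expR (- 2) * expR (- (2 * z ^+ 2)))%:E)%E).
      rewrite integral_cst//= lebesgue_measure_itv/= lte_fin gtrBl ltr01.
      by rewrite -EFinB opprB addrC subrK mule1.
    apply: ge0_le_integral_majorant => x /=.
      by rewrite lee_fin mulr_ge0 ?expR_ge0.
    rewrite in_itv/= => /andP[x1 x2]; rewrite lee_fin -expRD ler_expR.
    (* On [[z - 1, z[], [x ^+ 2 <= (1 - z) ^+ 2 <= 2 + 2 * z ^+ 2]; hence the factor [expR (-2)] and
       the rate 2. *)
    rewrite -opprD lerN2; apply: (@le_trans _ _ ((1 - z) ^+ 2)); last first.
      by have := sqr_ge0 (1 + z); nra.
    by rewrite -(sqrrN x) ler_sqr ?nnegrE; lra.
  rewrite integral_itv_bndo_bndc//.
  have fin : (\int[lebesgue_measure]_(x in `[z, 0%R]) (@gauss_fun R x)%:E)%E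
      \is a fin_num.
    apply: integrable_fin_num => //.
    exact: integrableS (@integrableT_gauss R).
  by rewrite -(fineK fin) -EFinD lee_fin.
rewrite mulrN -/I.
have e1 : (2 / Num.sqrt pi) * (Num.sqrt pi / 2) = 1 :> R.
  by rewrite mulrA divfK ?gt_eqF// divff.
rewrite lerBrDr -[leRHS]e1 -(mulrA (2 / _)) -mulrDr ler_pM2l//.
by rewrite divr_gt0.
Qed.

(** * Decay of the prior in the skewness parameter *)

Lemma normal_pdf_inv_peak (R : realType) (m s x : R) : s != 0 ->
  normal_fun m s x = (normal_peak s)^-1 * normal_pdf m s x.
Proof.
by move=> s0; rewrite normal_pdfE// mulKf// gt_eqF// normal_peak_gt0.
Qed.

Lemma integral_normal_fun (R : realType) (m s : R) : s != 0 ->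
  (\int[lebesgue_measure]_x (normal_fun m s x)%:E = ((normal_peak s)^-1)%:E)%E.
Proof.
move=> s0.
under eq_integral do rewrite normal_pdf_inv_peak// EFinM.
rewrite ge0_integralZl_EFin//.
- by rewrite integral_normal_pdf mule1.
- by move=> x _; rewrite lee_fin normal_pdf_ge0.
- by apply/measurable_EFinP; exact: measurable_normal_pdf.
- by rewrite invr_ge0 normal_peak_ge0.
Qed.

Lemma wasserstein_kernel_le (R : realType) :
  exists2 K : R, 0 <= K & forall alpha : R,
    (skew_normal_wasserstein_kernel alpha <= (K * (1 + alpha ^+ 2)^-1)%:E)%E.
Proof.
have [c c0 erfc] := @erf_lower_bound R.
have pi0 : 0 < (pi : R) `^ (3 / 2) by rewrite powR_gt0// pi_gt0.
have pc0 : 0 <= (pi : R) `^ (3 / 2) * c by rewrite ltW// mulr_gt0.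
(* [C / (1 + alpha ^+ 2) ^+ 2] will bound the integral under the root; [(normal_peak 1)^-1] is the
   integral of [expR (- (x ^+ 2 / 2))]. *)
pose C : R := Num.sqrt 2 / (pi `^ (3 / 2) * c) * (normal_peak 1)^-1.
have C0 : 0 <= C.
  by rewrite mulr_ge0 ?divr_ge0 ?invr_ge0 ?sqrtr_ge0 ?normal_peak_ge0.
exists (Num.sqrt C); first exact: sqrtr_ge0.
move=> alpha; have a0 : 0 < 1 + alpha ^+ 2 by rewrite ltr_pwDl// sqr_ge0.
have -> : Num.sqrt C * (1 + alpha ^+ 2)^-1 =
    Num.sqrt (C / (1 + alpha ^+ 2) ^+ 2).
  by rewrite [RHS]sqrtrM// -exprVn sqrtr_sqr ger0_norm// invr_ge0 ltW.
have erf1 x : 0 < erf (alpha * x / Num.sqrt 2) + 1.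
  by rewrite addrC (lt_le_trans _ (erfc _))// mulr_gt0// expR_gt0.
rewrite -[leRHS]/(sqrte (C / (1 + alpha ^+ 2) ^+ 2)%:E).
rewrite /skew_normal_wasserstein_kernel.
rewrite lee_sqrt ?lee_fin ?(divr_ge0 C0 (sqr_ge0 _))//.
pose q : R := Num.sqrt 2 / (pi `^ (3 / 2) * c) / (1 + alpha ^+ 2) ^+ 2.
have q0 : 0 <= q.
  by rewrite divr_ge0 ?sqr_ge0// divr_ge0 ?sqrtr_ge0.
have -> : C / (1 + alpha ^+ 2) ^+ 2 = q * (normal_peak 1)^-1.
  by rewrite /C /q mulrAC.
(* The bound is turned back into a Gaussian integral, so that integrands can be compared
   pointwise. *)
rewrite EFinM -(@integral_normal_fun R 0 1)// -ge0_integralZl_EFin//;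
  last 2 first.
- by move=> x _; rewrite lee_fin expR_ge0.
- by apply/measurable_EFinP; exact: measurable_normal_fun.
apply: ge0_le_integral_majorant => x _.
  rewrite lee_fin; apply: divr_ge0.
    by rewrite mulr_ge0 ?sqrtr_ge0 ?expR_ge0.
  apply: mulr_ge0; last by rewrite ltW.
  by apply: mulr_ge0; [rewrite ltW|rewrite sqr_ge0].
rewrite -EFinM lee_fin.
have -> : q * normal_fun 0 1 x =
    Num.sqrt 2 * expR (- (1 / 2 * (2 * alpha ^+ 2 + 1) * x ^+ 2)) /
     (pi `^ (3 / 2) * (alpha ^+ 2 + 1) ^+ 2
        * (c * expR (- (2 * (alpha * x / Num.sqrt 2) ^+ 2)))).
  (* In the exponent, [(2 * alpha ^+ 2 + 1) / 2 - alpha ^+ 2 = 1 / 2]. *)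
  have -> : normal_fun 0 1 x =
      expR (- (1 / 2 * (2 * alpha ^+ 2 + 1) * x ^+ 2))
      / expR (- (2 * (alpha * x / Num.sqrt 2) ^+ 2)).
    rewrite -expRN -expRD /normal_fun; congr expR.
    by rewrite !exprMn exprVn sqr_sqrtr// subr0 opprK expr1n; lra.
  rewrite /q (addrC 1).
  field.
  rewrite !gt_eqF ?expR_gt0//.
  by rewrite addrC.
rewrite ler_wpM2l ?mulr_ge0 ?sqrtr_ge0 ?expR_ge0//.
have d0 : 0 < (pi : R) `^ (3 / 2) * (alpha ^+ 2 + 1) ^+ 2.
  by rewrite mulr_gt0// exprn_gt0// addrC.
rewrite lef_pV2 ?posrE.
- apply: ler_wpM2l; last by rewrite [leRHS]addrC; exact: erfc.
  exact: ltW.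
- by rewrite mulr_gt0.
- by rewrite (mulr_gt0 d0)// mulr_gt0// expR_gt0.
Qed.

(** * Bounds on the skew-normal density and likelihood *)

Lemma std_normal_cdf_ge0_le1 (R : realType) (x : R) :
  0 <= std_normal_cdf x <= 1.
Proof.
rewrite /std_normal_cdf fine_ge0//=.
rewrite -[leRHS]/(fine 1%E) fine_le ?fin_num_measure//.
exact: probability_le1.
Qed.

(** The normalising constant [1 / Num.sqrt (2 * pi)] is below 1. *)
Lemma std_normal_pdf_le (R : realType) (x : R) :
  std_normal_pdf x <= expR (- (x ^+ 2 / 2)).
Proof.
rewrite /std_normal_pdf normal_pdfE// /normal_fun subr0 expr1n mulNr.
have h : 1 < (1 : R) ^+ 2 * pi *+ 2.
  by rewrite expr1n mul1r mulr2n; have := pi_ge2 R; lra.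
rewrite ler_piMl ?expR_ge0// /normal_peak invf_le1.
  rewrite -[leLHS]sqrtr1 ler_sqrt; first exact: ltW.
  exact: ltW (lt_trans ltr01 h).
by rewrite sqrtr_gt0 (lt_trans ltr01).
Qed.

Lemma skew_normal_pdf_ge0 (R : realType) (mu sigma alpha x : R) : 0 < sigma ->
  0 <= skew_normal_pdf mu sigma alpha x.
Proof.
move=> s0.
have /andP[F0 _] := std_normal_cdf_ge0_le1 (alpha * ((x - mu) / sigma)).
by rewrite !mulr_ge0 ?normal_pdf_ge0// invr_ge0 ltW.
Qed.

Lemma skew_normal_pdf_le (R : realType) (mu sigma alpha x : R) : 0 < sigma ->
  skew_normal_pdf mu sigma alpha x
    <= 2 / sigma * expR (- (((x - mu) / sigma) ^+ 2 / 2)).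
Proof.
move=> s0.
have /andP[F0 F1] := std_normal_cdf_ge0_le1 (alpha * ((x - mu) / sigma)).
have s2 : 0 <= 2 / sigma by rewrite divr_ge0// ltW.
rewrite /skew_normal_pdf -mulrA ler_wpM2l//.
apply: le_trans (std_normal_pdf_le _).
by rewrite ler_piMr// normal_pdf_ge0.
Qed.

Lemma skew_normal_likelihood_le (R : realType) (n : nat) (x : 'I_n -> R)
    (i j : 'I_n) (mu sigma alpha : R) : 0 < sigma -> i != j ->
  \prod_(k < n) skew_normal_pdf mu sigma alpha (x k)
    <= (2 / sigma) ^+ n * expR (- ((x i - x j) ^+ 2 / 8 / sigma ^+ 2))
       * normal_fun (x i) (2 * sigma) mu.
Proof.
move=> s0 ij; have s2 : 0 <= 2 / sigma by rewrite divr_ge0// ltW.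
pose y k := (x k - mu) / sigma.
apply: (@le_trans _ _ (\prod_(k < n) (2 / sigma * expR (- (y k ^+ 2 / 2))))).
  by apply: ler_prod => k _; rewrite skew_normal_pdf_ge0//= skew_normal_pdf_le.
rewrite big_split/= prodr_const card_ord -mulrA ler_wpM2l ?exprn_ge0//.
rewrite (bigD1 i)//= (bigD1 j) 1?eq_sym//= mulrA -expRD.
(* The exponential factors of the observations other than [i] and [j] are at most 1 and are
   dropped. *)
apply: (@le_trans _ _ (expR (- (y i ^+ 2 / 2) - y j ^+ 2 / 2))).
  rewrite ler_piMr ?expR_ge0// Num.Theory.prodr_ile1// => k _.
  by rewrite expR_ge0 expR_le1 oppr_le0 divr_ge0 ?sqr_ge0.
rewrite -expRD ler_expR.
have -> : (x i - x j) ^+ 2 / 8 / sigma ^+ 2 = (y i - y j) ^+ 2 / 8.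
  by rewrite /y; field; rewrite gt_eqF.
(* The standard deviation [2 * sigma] is the one that produces the exponent [y i ^+ 2 / 8]. *)
have -> : - (mu - x i) ^+ 2 / ((2 * sigma) ^+ 2 *+ 2) = - (y i ^+ 2 / 8).
  by rewrite /y; field; rewrite gt_eqF.
(* [y i ^+ 2 + y j ^+ 2 >= (y i ^+ 2 + (y i - y j) ^+ 2) / 4] leaves a Gaussian
   factor in mu, and one free of mu that forces decay as sigma tends to 0. *)
have := sqr_ge0 (y i + y j); have := sqr_ge0 (y j); have := sqr_ge0 (y i).
by nra.
Qed.

(** * Finiteness of the marginal likelihood when two observations differ *)

(** The Gaussian in [mu] integrates to [sigma * Num.sqrt (pi *+ 8)]; this [sigma] cancels one of the
    [n] factors [1 / sigma], whence the power [n.-1]. [p] stands for the prior as a function of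
    [mu]. *)
Lemma integral_skew_normal_likelihood_mu_le (R : realType) (n : nat)
    (x : 'I_n -> R) (i j : 'I_n) (sigma alpha k : R) (p : R -> \bar R) :
  0 < sigma -> i != j -> 0 <= k -> (0 < n)%N ->
  (forall mu, (0 <= p mu <= k%:E)%E) ->
  (\int[lebesgue_measure]_(mu in [set: R])
     ((\prod_(l < n) skew_normal_pdf mu sigma alpha (x l))%:E * p mu)
   <= (2 ^+ n * Num.sqrt (pi *+ 8) * k *
       (sigma ^- n.-1 * expR (- ((x i - x j) ^+ 2 / 8 / sigma ^+ 2))))%:E)%E.
Proof.
move=> s0 ij k0 n0 pk; set e := expR _.
have e0 : 0 <= e by exact: expR_ge0.
pose q := k * ((2 / sigma) ^+ n * e).
have q0 : 0 <= q.
  by rewrite !mulr_ge0 ?exprn_ge0 ?divr_ge0// ltW.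
have L0 mu : 0 <= \prod_(l < n) skew_normal_pdf mu sigma alpha (x l).
  by apply: prodr_ge0 => l _; exact: skew_normal_pdf_ge0.
apply: (@le_trans _ _ (\int[lebesgue_measure]_mu
    (q%:E * (normal_fun (x i) (2 * sigma) mu)%:E))%E).
  apply: ge0_le_integral_majorant => mu _.
    by have /andP[p0 _] := pk mu; rewrite mule_ge0// lee_fin.
  have /andP[p0 pk'] := pk mu.
  apply: (@le_trans _ _ ((\prod_(l < n) skew_normal_pdf mu sigma alpha (x l))%:E
      * k%:E)%E).
    by rewrite lee_wpmul2l// lee_fin.
  rewrite -!EFinM lee_fin mulrC /q -mulrA ler_wpM2l//.
  exact: skew_normal_likelihood_le.
rewrite ge0_integralZl_EFin//; last 2 first.
- by move=> mu _; rewrite lee_fin expR_ge0.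
- by apply/measurable_EFinP; exact: measurable_normal_fun.
rewrite integral_normal_fun ?mulf_neq0 ?gt_eqF// -EFinM lee_fin.
rewrite /normal_peak invrK.
have -> : (2 * sigma) ^+ 2 * pi *+ 2 = sigma ^+ 2 * (pi *+ 8).
  by rewrite -[X in _ = _ * X]mulr_natr -mulr_natr; ring.
rewrite sqrtrM ?sqr_ge0// sqrtr_sqr gtr0_norm// /q -(prednK n0) exprMn /=.
rewrite -exprVn [(sigma^-1) ^+ _.+1]exprSr le_eqVlt; apply/orP; left; apply/eqP.
by field; rewrite gt_eqF.
Qed.

(** Once [mu] is integrated out, the bound is a constant times the product of [1 / (1 + sigma ^+ 2)]
    and [1 / (1 + alpha ^+ 2)], so each remaining integral contributes at most the finite factor
    [J]. *)
Lemma posterior_proper_of_neq (R : realType) (prior : R -> R -> R -> \bar R)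
    (n : nat) (x : 'I_n -> R) (i j : 'I_n) :
  is_skew_normal_wasserstein_prior prior -> (2 < n)%N -> x i != x j ->
  posterior_proper prior x.
Proof.
move=> [c [c0 priorE]] n2 xij.
have ij : i != j by apply: contraNneq xij => ->.
have n0 : (0 < n)%N by exact: leq_trans n2.
have [K K0 kerK] := @wasserstein_kernel_le R.
have D0 : 0 < (x i - x j) ^+ 2 / 8.
  by rewrite divr_gt0// exprn_even_gt0//= subr_eq0.
(* Here [n > 2] enters: the power of [1 / sigma] left after integrating [mu] is at least 2, enough
   for integrability at infinity. *)
have n1 : (2 <= n.-1)%N by rewrite -ltnS prednK.
have [M M0 decay] := expr_inv_expRN_decay n1 D0.
pose J := fine (\int[lebesgue_measure]_(t in [set: R]) ((1 + t ^+ 2)^-1)%:E)%E.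
have V0 (t : R) : 0 <= (1 + t ^+ 2)^-1 by rewrite invr_ge0 addr_ge0 ?sqr_ge0.
have JE : (\int[lebesgue_measure]_(t in [set: R]) ((1 + t ^+ 2)^-1)%:E
    = J%:E)%E.
  rewrite fineK// ge0_fin_numE ?integral_oneDsqrV_fin// integral_ge0// => t _.
  by rewrite lee_fin.
have J0 : 0 <= J by rewrite -lee_fin -JE integral_ge0// => t _; rewrite lee_fin.
have intV (q : R) : 0 <= q ->
    (\int[lebesgue_measure]_(t in [set: R]) (q * (1 + t ^+ 2)^-1)%:E
      = (q * J)%:E)%E.
  move=> q0; under eq_integral do rewrite EFinM.
  rewrite ge0_integralZl_EFin ?JE//.
    by move=> t _; rewrite lee_fin.
  by apply/measurable_EFinP; exact: measurable_oneDsqrV.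
(* [B] collects the constants from the integral in [mu], the prior, and the decay in [sigma]. *)
pose B := 2 ^+ n * Num.sqrt (pi *+ 8) * (c * K) * M.
have B0 : 0 <= B by rewrite !mulr_ge0 ?exprn_ge0 ?sqrtr_ge0// ltW.
have ker0 alpha : (0 <= skew_normal_wasserstein_kernel alpha :> \bar R)%E.
  exact: sqrte_ge0.
have int0 sigma alpha : 0 < sigma -> forall mu, (0 <=
    (\prod_(l < n) skew_normal_pdf mu sigma alpha (x l))%:E
      * prior mu sigma alpha)%E.
  move=> s0 mu; rewrite priorE// !mule_ge0 ?lee_fin ?(ltW c0)//.
  by apply: prodr_ge0 => l _; exact: skew_normal_pdf_ge0.
have intmu sigma alpha : 0 < sigma ->
    (\int[lebesgue_measure]_(mu in [set: R])
      ((\prod_(l < n) skew_normal_pdf mu sigma alpha (x l))%:E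
        * prior mu sigma alpha)
     <= (B / (1 + sigma ^+ 2) * (1 + alpha ^+ 2)^-1)%:E)%E.
  move=> s0; have k0 : 0 <= c * (K * (1 + alpha ^+ 2)^-1).
    by rewrite mulr_ge0 ?(ltW c0)// mulr_ge0.
  have p01 mu : (0 <= prior mu sigma alpha
      <= (c * (K * (1 + alpha ^+ 2)^-1))%:E)%E.
    rewrite priorE// EFinM mule_ge0 ?lee_fin ?(ltW c0)//=.
    by rewrite lee_wpmul2l// lee_fin ltW.
  apply: (le_trans (@integral_skew_normal_likelihood_mu_le R n x i j
    sigma alpha _ (fun mu => prior mu sigma alpha) s0 ij k0 n0 p01)).
  rewrite lee_fin; have {}decay := decay _ s0.
  set E := (X in _ * X); rewrite -/E in decay.
  pose w := 2 ^+ n * Num.sqrt (pi *+ 8) * (c * K) / (1 + alpha ^+ 2).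
  have w0 : 0 <= w by rewrite !mulr_ge0 ?exprn_ge0 ?sqrtr_ge0// ltW.
  rewrite (_ : _ * E = w * E); last by rewrite /w; ring.
  rewrite (_ : _ * _^-1 = w * (M / (1 + sigma ^+ 2))).
    exact: ler_wpM2l.
  by rewrite /w /B; ring.
rewrite /posterior_proper /marginal_likelihood.
apply: (@le_lt_trans _ _ (\int[lebesgue_measure]_(sigma in `]0%R, +oo[)
    (B * J * (1 + sigma ^+ 2)^-1)%:E)%E).
  apply: ge0_le_integral_majorant => sigma /=; rewrite in_itv/= andbT => s0.
    by apply: integral_ge0 => alpha _; apply: integral_ge0 => mu _; exact: int0.
  rewrite mulrAC -intV ?(mulr_ge0 B0 (V0 _))//.
  apply: ge0_le_integral_majorant => alpha _; last exact: intmu.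
  by apply: integral_ge0 => mu _; exact: int0.
have BJ0 : 0 <= B * J by rewrite mulr_ge0.
apply: (@le_lt_trans _ _ (B * J * J)%:E); last exact: ltry.
(* The half-line of [sigma] is enlarged to the whole line, so that [J] serves again. *)
rewrite -intV//; apply: ge0_subset_integral => //.
  apply/measurable_EFinP/measurable_funM => //; exact: measurable_oneDsqrV.
by move=> t _; rewrite lee_fin mulr_ge0.
Qed.

(** * Ties between observations have probability zero *)

Lemma measurable_eq_RV d (T : measurableType d) (R : realType)
    (P : probability T R) (X Y : {RV P >-> R}) : measurable [set w | X w = Y w].
Proof.
rewrite (_ : [set w | _] = setT `&` (fun w => X w == Y w) @^-1` [set true]).
  exact: measurable_fun_eqr.
by rewrite setTI; apply/seteqP; split => w /= /eqP.
Qed.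

(* For each [k], the event that |X| and |Y| both lie in [k h, (k + 1) h[ has
   probability at most [2 M h P (k h <= |Y| < (k + 1) h)]; sum over [k] and let
   [h] tend to 0. *)
Lemma prob_eq_eq0 d (T : measurableType d) (R : realType) (P : probability T R)
    (X Y : {RV P >-> R}) (M : R) : 0 < M ->
  (forall A, measurable A ->
     P (X @^-1` A `&` Y @^-1` A) = (P (X @^-1` A) * P (Y @^-1` A))%E) ->
  (forall A, measurable A -> (P (X @^-1` A) <= M%:E * lebesgue_measure A)%E) ->
  P [set w | X w = Y w] = 0%E.
Proof.
move=> M0 indep dens; apply/eqP; rewrite -measure_le0.
apply/lee_addgt0Pr => e e0; rewrite add0e.
(* This choice gives [2 * M * h = e]. *)
pose h := e / (M * 2).
have h0 : 0 < h by rewrite divr_gt0// mulr_gt0.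
pose A k := [set x : R | k%:R * h <= `|x| < k.+1%:R * h].
have mA k : measurable (A k).
  have -> : A k = [set: R] `&`
      (fun x : R => `|x|) @^-1` `[k%:R * h, k.+1%:R * h[%classic.
    by rewrite setTI; apply/seteqP; split => x /=; rewrite in_itv.
  exact: normr_measurable.
(* The cell [A k] is covered by two intervals of length [h], one on each side of 0. *)
have lebA k : (lebesgue_measure (A k) <= (2 * h)%:E)%E.
  have leba (a b : R) : a <= b -> lebesgue_measure `[a, b] = (b - a)%:E.
    rewrite le_eqVlt => /predU1P[->|ab].
      by rewrite subrr set_itv1 lebesgue_measure_set1.
    by rewrite lebesgue_measure_itv/= lte_fin ab -EFinB.
  have kh : k%:R * h <= k.+1%:R * h by rewrite ler_pM2r// ler_nat.
  pose I1 : set R := `[- (k.+1%:R * h), - (k%:R * h)]%classic.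
  pose I2 : set R := `[k%:R * h, k.+1%:R * h]%classic.
  apply: (@le_trans _ _ (lebesgue_measure (I1 `|` I2))).
    apply: le_measure; rewrite ?inE; first exact: mA.
      by apply: measurableU; exact: measurable_itv.
    move=> x /= /andP[kx xk]; rewrite /I1 /I2/= !in_itv/=.
    have [x0|x0] := leP 0 x; [right|left].
      by rewrite ger0_norm// in kx xk; rewrite kx ltW.
    by rewrite ltr0_norm// in kx xk; rewrite lerNl (ltW xk) lerNr.
  apply: (@le_trans _ _ (lebesgue_measure I1 + lebesgue_measure I2)%E).
    by apply: measureU2; exact: measurable_itv.
  rewrite /I1 leba ?lerN2// /I2 leba// -EFinD lee_fin -natr1; lra.
have coverA x : exists k, A k x.
  exists (Num.truncn (`|x| / h)); rewrite /A/=.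
  by rewrite -ler_pdivlMr// -ltr_pdivrMr// truncn_itv// divr_ge0// ltW.
have trivA : trivIset setT (fun k => Y @^-1` A k).
  apply/trivIsetP => k l _ _ kl; rewrite -subset0 => w [] /=.
  move=> /andP[a1 a2] /andP[b1 b2]; move/eqP: kl; apply.
  have := le_lt_trans a1 b2; have := le_lt_trans b1 a2.
  rewrite !ltr_pM2r// !ltr_nat !ltnS => lk kl.
  by apply/eqP; rewrite eqn_leq kl lk.
have mY k : measurable (Y @^-1` A k) by exact: measurable_funPTI.
have mX k : measurable (X @^-1` A k) by exact: measurable_funPTI.
have mE := measurable_eq_RV X Y.
apply: (@le_trans _ _ (\sum_(0 <= k <oo) P (X @^-1` A k `&` Y @^-1` A k))%E).
  apply: measure_sigma_subadditive => //.
    by move=> k; exact: measurableI.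
  move=> w /= XY; have [k Ak] := coverA (X w).
  by exists k => //; split => //=; rewrite -XY.
apply: (@le_trans _ _ (\sum_(0 <= k <oo) (e%:E * P (Y @^-1` A k)))%E).
  apply: lee_nneseries => k _; first by rewrite measure_ge0.
  (* Independence splits the probability; the density bound makes the factor of [X] at most [e]. *)
  rewrite indep// lee_wpmul2r ?measure_ge0//.
  apply: (le_trans (dens _ (mA k))).
  have -> : e%:E = (M%:E * (2 * h)%:E)%E.
    by rewrite -EFinM /h; congr EFin; field; rewrite gt_eqF.
  by rewrite lee_wpmul2l// lee_fin ltW.
rewrite nneseriesZl; last by move=> k _; rewrite measure_ge0.
(* The cells are disjoint, so the probabilities for [Y] add up to at most 1. *)
rewrite -[leRHS]mule1 lee_wpmul2l//; first by rewrite lee_fin ltW.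
have := measure_bigcup P setT (fun k => Y @^-1` A k) (fun k _ => mY k) trivA.
under [X in _ = X -> _]eq_eseriesl do rewrite in_setT.
move=> <-; apply: probability_le1; exact: bigcup_measurable.
Qed.

Theorem theorem4 (R : realType) (d : measure_display) (T : measurableType d)
    (P : probability T R) (n : nat) (X : 'I_n -> {RV P >-> R})
    (mu0 sigma0 alpha0 : R) (prior : R -> R -> R -> \bar R) :
  0 < sigma0 ->
  iid_skew_normal_sample X mu0 sigma0 alpha0 ->
  is_skew_normal_wasserstein_prior prior ->
  (2 < n)%N ->
  {ae P, forall omega, posterior_proper prior (fun i : 'I_n => X i omega)}.
Proof.
move=> s0 [indep dens] priorE n2.
(* A tie between the first two observations is the only event to exclude. *)
pose i : 'I_n := Ordinal (ltn_trans (isT : (0 < 2)%N) n2).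
pose j : 'I_n := Ordinal (ltn_trans (isT : (1 < 2)%N) n2).
have ij : i != j by [].
have XijE : P [set w | X i w = X j w] = 0%E.
  (* The density is at most [2 / sigma0], since its Gaussian factor and [Phi] are at most 1. *)
  apply: (@prob_eq_eq0 _ _ _ _ _ _ (2 / sigma0)) => [|A mA|A mA].
  - by rewrite divr_gt0.
  (* Mutual independence is applied to the pair [i], [j] with the same set [A] for both. *)
  - have := indep [set i; j]%SET (fun=> A) (fun _ _ => mA).
    rewrite big_setU1 ?inE//= big_set1 => <-; congr (P _).
    apply/seteqP; split => [w [wi wj] k /=|w wA].
      by rewrite !inE => /orP[] /eqP ->.
    by split; apply: wA => /=; rewrite !inE eqxx ?orbT.
  - have -> : P (X i @^-1` A) = distribution P (X i) A by [].
    rewrite dens// -integral_cst//; apply: ge0_le_integral_majorant => x _.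
      by rewrite lee_fin skew_normal_pdf_ge0.
    rewrite lee_fin (le_trans (skew_normal_pdf_le _ _ _ s0))//.
    apply: ler_piMr; first by rewrite divr_ge0// ltW.
    by rewrite expR_le1 oppr_le0 divr_ge0 ?sqr_ge0.
exists [set w | X i w = X j w]; split => //.
  exact: measurable_eq_RV.
move=> w /=; apply: contra_notP => Xij.
by apply: (posterior_proper_of_neq (i := i) (j := j)) => //; apply/eqP.
Qed.
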